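(* Let $(A,\sigma,u,\Lambda)$ be a semiperfect unitary ring, and let $(P,[\beta])$, $(Q_1,[\gamma_1])$, $(Q_2,[\gamma_2])$ be quadratic spaces over it such that $(P,[\beta])$ is unimodular and $$(P,[\beta])\perp(Q_1,[\gamma_1])\cong(P,[\beta])\perp(Q_2,[\gamma_2]).$$ Then $(Q_1,[\gamma_1])\cong(Q_2,[\gamma_2])$.
   Context: Rings are associative and unital. An anti-structure on a ring $A$ is a pair $(\sigma,u)$ where $\sigma:A\to A$, $a\mapsto a^\sigma$, is an anti-automorphism and $u\in A^\times$ satisfies $u^\sigma u=1$ and $a^{\sigma\sigma}=uau^{-1}$ for all $a$. Put $\Lambda^{\min}=\{a-a^\sigma u: a\in A\}$, $\Lambda^{\max}=\{a\in A: a^\sigma u=-a\}$. A form parameter is an additive group $\Lambda$ with $\Lambda^{\min}\subseteq\Lambda\subseteq\Lambda^{\max}$ and $a^\sigma\Lambda a\subseteq\Lambda$ for all $a\in A$; then $(A,\sigma,u,\Lambda)$ is called a unitary ring. It is called semiperfect if $A$ is semiperfect, i.e. $A$ is semilocal and idempotents lift modulo $\mathrm{Jac}(A)$. Let $\mathcal{P}(A)$ be the category of finitely generated projective right $A$-modules. For $P\in\mathcal{P}(A)$, $P^*=\mathrm{Hom}_A(P,A)$ is a right $A$-module via $(fa)(x)=a^\sigma f(x)$. A sesquilinear form on $P$ is a biadditive $\beta:P\times P\to A$ with $\beta(xa,yb)=a^\sigma\beta(x,y)b$; these form an abelian group $\mathcal{S}_P$. $\Lambda_P\subseteq\mathcal{S}_P$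 is the subgroup of all $\gamma$ with $\gamma(x,y)=-\gamma(y,x)^\sigma u$ and $\gamma(x,x)\in\Lambda$ for all $x,y$. A quadratic space is a pair $(P,[\beta])$ with $P\in\mathcal{P}(A)$ and $[\beta]\in\mathcal{S}_P/\Lambda_P$. Set $h_\beta(x,y)=\beta(x,y)+\beta(y,x)^\sigma u$ (it depends only on $[\beta]$); $(P,[\beta])$ is unimodular if $P\to P^*$, $x\mapsto[y\mapsto h_\beta(x,y)]$, is an isomorphism. An isometry $(P,[\beta])\to(P',[\beta'])$ is an $A$-module isomorphism $\psi$ with $[\beta'(\psi\cdot,\psi\cdot)]=[\beta]$; $\cong$ between quadratic spaces means that an isometry exists. The orthogonal sum $(P,[\beta])\perp(Q,[\gamma])$ is $(P\oplus Q,[\beta\perp\gamma])$ with $(\beta\perp\gamma)(x\oplus y,x'\oplus y')=\beta(x,x')+\gamma(y,y')$. *)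

(* Defs.v *)
From HB Require Import structures.
From mathcomp Require Import all_boot all_order all_algebra.
From mathcomp Require Import boolp classical_sets.
Set Implicit Arguments.
Unset Strict Implicit.
Unset Printing Implicit Defensive.
Import GRing.Theory.
Local Open Scope ring_scope.
Local Open Scope classical_set_scope.

(* Rings are [pzRingType]s, so the zero ring is allowed. A right A-module is a
   left module over the converse ring A^c: for [a : A^c], the term [a *: x] is
   the product of x by a on the right, and [a *: (b *: x)] is x(ba). In
   particular (A^c)^o is A as a right module over itself. *)

Definition surjective (T U : Type) (f : T -> U) : Prop :=
  forall y, exists x, f x = y.

Definition right_ideal (A : pzRingType) (I : set A) : Prop :=
  [/\ I 0, forall x y, I x -> I y -> I (x + y) & forall x a, I x -> I (x * a)].

Definition maximal_right_ideal (A : pzRingType) (I : set A) : Prop :=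
  [/\ right_ideal I, I <> setT
    & forall I' : set A, right_ideal I' -> I `<=` I' -> I' = I \/ I' = setT].

Definition jacobson (A : pzRingType) : set A :=
  [set x | forall I : set A, maximal_right_ideal I -> I x].

(* A is semisimple as a right module over itself: every right ideal is a
   direct summand. Such a ring is automatically artinian. *)
Definition semisimple_ring (A : pzRingType) : Prop :=
  forall I : set A, right_ideal I ->
  exists I' : set A,
    [/\ right_ideal I', I `&` I' = [set 0]
      & forall x, exists y z, [/\ I y, I' z & x = y + z]].

(* B is the quotient ring A / Jac(A), given through the projection pi. *)
Definition semilocal (A : pzRingType) : Prop :=
  exists (B : pzRingType) (pi : {rmorphism A -> B}),
    [/\ surjective pi, forall x, pi x = 0 <-> jacobson x & semisimple_ring B].

Definition idempotents_lift_mod (A : pzRingType) (J : set A) : Prop :=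
  forall e : A, J (e * e - e) -> exists f : A, f * f = f /\ J (f - e).

Definition semiperfect (A : pzRingType) : Prop :=
  semilocal A /\ idempotents_lift_mod (@jacobson A).

Record anti_automorphism (A : pzRingType) (s : A -> A) : Prop := {
  anti_autD : forall a b, s (a + b) = s a + s b;
  anti_aut1 : s 1 = 1;
  anti_autM : forall a b, s (a * b) = s b * s a;
  anti_aut_bij : bijective s }.

Record anti_structure (A : pzRingType) := AntiStructure {
  asigma :> A -> A;
  aunit : A;
  aunitV : A;
  asigmaP : anti_automorphism asigma;
  aunit_mulV : aunit * aunitV = 1;
  aunit_Vmul : aunitV * aunit = 1;
  asigma_unit : asigma aunit * aunit = 1;
  asigmaK : forall a, asigma (asigma a) = aunit * a * aunitV }.

Definition Lambda_min (A : pzRingType) (s : anti_structure A) : set A :=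
  [set a - s a * aunit s | a in setT].

Definition Lambda_max (A : pzRingType) (s : anti_structure A) : set A :=
  [set a | s a * aunit s = - a].

Record form_parameter (A : pzRingType) (s : anti_structure A) := FormParameter {
  fparam : set A;
  fparam0 : fparam 0;
  fparamB : forall a b, fparam a -> fparam b -> fparam (a - b);
  fparam_min : Lambda_min s `<=` fparam;
  fparam_max : fparam `<=` Lambda_max s;
  fparamJ : forall a b, fparam b -> fparam (s a * b * a) }.

Definition finitely_generated (R : pzRingType) (P : lmodType R) : Prop :=
  exists (n : nat) (e : 'I_n -> P),
    forall x, exists a : 'I_n -> R, x = \sum_i a i *: e i.

Definition projective (R : pzRingType) (P : lmodType R) : Prop :=
  forall (M N : lmodType R) (f : {linear M -> N}) (g : {linear P -> N}),
  surjective f -> exists h : {linear P -> M}, forall x, f (h x) = g x.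

Definition fg_projective (R : pzRingType) (P : lmodType R) : Prop :=
  finitely_generated P /\ projective P.

Lemma fg_projective_prod (R : pzRingType) (P Q : lmodType R) :
  fg_projective P -> fg_projective Q -> fg_projective (P * Q)%type.
Proof.
move=> [[n [e eP]] projP] [[m [d dQ]] projQ]; split.
  exists (n + m)%N, (fun i => match split i with
    inl j => (e j, 0) | inr j => (0, d j) end) => -[x y].
  have [a ->] := eP x; have [b ->] := dQ y.
  exists (fun i => match split i with inl j => a j | inr j => b j end).
  rewrite big_split_ord /=.
  have sl i : split (lshift m i) = inl i := @unsplitK n m (inl i).
  have sr i : split (rshift n i) = inr i := @unsplitK n m (inr i).
  under [X in _ = X + _]eq_bigr => i _ do rewrite sl.
  under [X in _ = _ + X]eq_bigr => i _ do rewrite sr.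
  have fst_sum k (F : 'I_k -> P * Q) : (\sum_i F i).1 = \sum_i (F i).1.
    by apply: (big_morph (fun z : P * Q => z.1)).
  have snd_sum k (F : 'I_k -> P * Q) : (\sum_i F i).2 = \sum_i (F i).2.
    by apply: (big_morph (fun z : P * Q => z.2)).
  apply: injective_projections => /=; rewrite !(fst_sum, snd_sum) /=.
    by rewrite [X in _ = _ + X]big1 ?addr0 // => i _; rewrite scaler0.
  by rewrite [X in _ = X + _]big1 ?add0r // => i _; rewrite scaler0.
move=> M N f g fsurj.
have inl_lin : linear (fun x : P => (x, 0) : P * Q).
  by move=> a x y; apply: injective_projections => //=; rewrite scaler0 addr0.
have inr_lin : linear (fun y : Q => (0, y) : P * Q).
  by move=> a x y; apply: injective_projections => //=; rewrite scaler0 addr0.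
pose il : {linear P -> (P * Q)%type} := HB.pack (fun x : P => (x, 0) : P * Q)
  (GRing.isLinear.Build R P (P * Q)%type _ _ inl_lin).
pose ir : {linear Q -> (P * Q)%type} := HB.pack (fun y : Q => (0, y) : P * Q)
  (GRing.isLinear.Build R Q (P * Q)%type _ _ inr_lin).
have [h1 h1P] := projP M N f (g \o il) fsurj.
have [h2 h2P] := projQ M N f (g \o ir) fsurj.
have h_lin : linear (fun z : P * Q => h1 z.1 + h2 z.2).
  by move=> a x y; rewrite /= !linearP scalerDr addrACA.
pose h : {linear (P * Q)%type -> M} :=
  HB.pack (fun z : P * Q => h1 z.1 + h2 z.2)
    (GRing.isLinear.Build R (P * Q)%type M _ _ h_lin).
exists h => -[x y] /=.
rewrite linearD h1P h2P /= -linearD; congr (g _).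
by apply: injective_projections; rewrite /= ?addr0 ?add0r.
Qed.

(* Hom_A(P, A), with the right action (f a)(x) = a^sigma f(x). *)
Definition dual (A : pzRingType) (s : anti_structure A) (P : lmodType A^c) :=
  {linear P -> (A^c)^o}.

Section Dual.
Variables (A : pzRingType) (s : anti_structure A) (P : lmodType A^c).

Lemma dual_ext (f g : dual s P) : (forall x, f x = g x) -> f = g.
Proof.
case: f g => [f fl] [g gl] /= fg.
have {}fg : f = g by apply/funext => x; exact: fg.
case: _ / fg in gl *; congr GRing.Linear.Pack.
case: fl gl => [[f1] [f2]] [[g1] [g2]].
by rewrite (Prop_irrelevance f1 g1) (Prop_irrelevance f2 g2).
Qed.

HB.instance Definition _ := gen_eqMixin (dual s P).
HB.instance Definition _ := gen_choiceMixin (dual s P).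

Definition dual_zero : dual s P := \0 : {linear P -> (A^c)^o}.
Definition dual_opp (f : dual s P) : dual s P :=
  (\- f)%R : {linear P -> (A^c)^o}.
Definition dual_add (f g : dual s P) : dual s P :=
  (f \+ g)%R : {linear P -> (A^c)^o}.

Fact dual_addA : associative dual_add.
Proof. by move=> f g h; apply: dual_ext => x; apply: addrA. Qed.
Fact dual_addC : commutative dual_add.
Proof. by move=> f g; apply: dual_ext => x; apply: addrC. Qed.
Fact dual_add0 : left_id dual_zero dual_add.
Proof. by move=> f; apply: dual_ext => x; apply: add0r. Qed.
Fact dual_addN : left_inverse dual_zero dual_opp dual_add.
Proof. by move=> f; apply: dual_ext => x; apply: addNr. Qed.

HB.instance Definition _ := GRing.isZmodule.Build (dual s P)
  dual_addA dual_addC dual_add0 dual_addN.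

Definition dual_scale_fun (a : A) (f : dual s P) (x : P) : (A^c)^o :=
  s a * (f x : A).

Fact dual_scale_linear (a : A) (f : dual s P) : linear (dual_scale_fun a f).
Proof.
move=> b x y; rewrite /dual_scale_fun linearP.
by rewrite [LHS](@mulrDr A) [X in X + _ = _](@mulrA A).
Qed.

HB.instance Definition _ (a : A) (f : dual s P) :=
  GRing.isLinear.Build A^c P (A^c)^o _ (dual_scale_fun a f)
    (dual_scale_linear a f).

Definition dual_scale (a : A^c) (f : dual s P) : dual s P :=
  dual_scale_fun a f : {linear P -> (A^c)^o}.

Fact dual_scaleA (a b : A^c) (f : dual s P) :
  dual_scale a (dual_scale b f) = dual_scale (a * b) f.
Proof.
apply: dual_ext => x; rewrite /= /dual_scale_fun.
by rewrite (anti_autM (asigmaP s)) [LHS](@mulrA A).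
Qed.
Fact dual_scale1 : left_id 1 dual_scale.
Proof.
move=> f; apply: dual_ext => x.
by rewrite /= /dual_scale_fun (anti_aut1 (asigmaP s)) [LHS](@mul1r A).
Qed.
Fact dual_scaleDr : right_distributive dual_scale +%R.
Proof. by move=> a f g; apply: dual_ext => x; apply: (@mulrDr A). Qed.
Fact dual_scaleDl (f : dual s P) :
  {morph dual_scale^~ f : a b / a + b >-> a + b}.
Proof.
move=> a b; apply: dual_ext => x.
by rewrite /= /dual_scale_fun (anti_autD (asigmaP s)) [LHS](@mulrDl A).
Qed.

HB.instance Definition _ := GRing.Zmodule_isLmodule.Build A^c (dual s P)
  dual_scaleA dual_scale1 dual_scaleDr dual_scaleDl.

End Dual.

Record sesquilinear (A : pzRingType) (s : anti_structure A) (P : lmodType A^c)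
    (beta : P -> P -> A) : Prop := {
  sesqDl : forall x x' y, beta (x + x') y = beta x y + beta x' y;
  sesqDr : forall x y y', beta x (y + y') = beta x y + beta x y';
  sesqZ : forall x y (a b : A),
    beta ((a : A^c) *: x) ((b : A^c) *: y) = s a * beta x y * b }.

(* The subgroup Lambda_P of the group S_P of sesquilinear forms on P. *)
Definition Lambda_forms (A : pzRingType) (s : anti_structure A)
    (L : form_parameter s) (P : lmodType A^c) : set (P -> P -> A) :=
  [set gamma | [/\ sesquilinear s gamma,
                   forall x y, gamma x y = - (s (gamma y x) * aunit s)
                 & forall x, fparam L (gamma x x)]].

(* [beta] = [beta'] in S_P / Lambda_P. *)
Definition form_equiv (A : pzRingType) (s : anti_structure A)
    (L : form_parameter s) (P : lmodType A^c) (beta beta' : P -> P -> A) : Prop :=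
  Lambda_forms L (fun x y => beta x y - beta' x y).

Definition hform (A : pzRingType) (s : anti_structure A) (P : lmodType A^c)
    (beta : P -> P -> A) (x y : P) : A :=
  beta x y + s (beta y x) * aunit s.

Lemma hform_equiv (A : pzRingType) (s : anti_structure A)
    (L : form_parameter s) (P : lmodType A^c) (beta beta' : P -> P -> A) :
  form_equiv L beta beta' -> hform s beta = hform s beta'.
Proof.
move=> [_ H _]; apply/funext => x; apply/funext => y; rewrite /hform.
have sB a b : s (a - b) = s a - s b.
  by apply/(addIr (s b)); rewrite -(anti_autD (asigmaP s)) !subrK.
apply/eqP; rewrite -subr_eq0 opprD addrACA; apply/eqP.
by rewrite -mulrBl -sB H addNr.
Qed.

(* The pair (P, [beta]) is given by a representative beta of its class. *)
Record quadratic_space (A : pzRingType) (s : anti_structure A) := QSpace {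
  qmod :> lmodType A^c;
  qform : qmod -> qmod -> A;
  qmod_fgproj : fg_projective qmod;
  qform_sesq : sesquilinear s qform }.

Section Adjoint.
Variables (A : pzRingType) (s : anti_structure A) (P : quadratic_space s).

Definition adjoint_fun (x y : P) : (A^c)^o := hform s (@qform A s P) x y.

Fact adjoint_fun_linear (x : P) : linear (adjoint_fun x).
Proof.
have [Dl Dr Z] := qform_sesq P; have [sD s1 sM _] := asigmaP s.
move=> b y z; rewrite /adjoint_fun /hform Dr Dl sD mulrDl addrACA.
congr (_ + _).
have := Z x y 1 b; rewrite scale1r s1 mul1r => ->.
have := Z y x b 1; rewrite scale1r mulr1 => ->.
rewrite sM asigmaK -!mulrA aunit_Vmul mulr1.
by rewrite [RHS](@mulrDl A) -!mulrA.
Qed.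

HB.instance Definition _ (x : P) :=
  GRing.isLinear.Build A^c P (A^c)^o _ (adjoint_fun x) (adjoint_fun_linear x).

Definition adjoint (x : P) : dual s P := adjoint_fun x : {linear P -> (A^c)^o}.

Fact adjoint_linear : linear adjoint.
Proof.
have [Dl Dr Z] := qform_sesq P; have [sD s1 sM _] := asigmaP s.
move=> a x y; apply: dual_ext => z.
change (hform s (@qform A s P) (a *: x + y) z
  = s a * hform s (@qform A s P) x z + hform s (@qform A s P) y z).
rewrite /hform Dr Dl sD mulrDl addrACA mulrDr.
have := Z x z a 1; rewrite scale1r mulr1 => ->.
have := Z z x 1 a; rewrite scale1r s1 mul1r => ->.
by rewrite sM mulrA.
Qed.

HB.instance Definition _ :=
  GRing.isLinear.Build A^c P (dual s P) _ adjoint adjoint_linear.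

Definition unimodular : Prop := bijective (adjoint : {linear P -> dual s P}).

End Adjoint.

Definition isometric (A : pzRingType) (s : anti_structure A)
    (L : form_parameter s) (P P' : quadratic_space s) : Prop :=
  exists psi : {linear P -> P'},
    bijective psi
    /\ form_equiv L (fun x y => qform (psi x) (psi y)) (@qform A s P).

Section OrthogonalSum.
Variables (A : pzRingType) (s : anti_structure A) (P Q : quadratic_space s).

Definition osum_form (z z' : P * Q) : A := qform z.1 z'.1 + qform z.2 z'.2.

Fact osum_form_sesq : sesquilinear s osum_form.
Proof.
have [Dl Dr Z] := qform_sesq P; have [Dl' Dr' Z'] := qform_sesq Q.
split=> [x x' y|x y y'|x y a b]; rewrite /osum_form /=.
- by rewrite Dl Dl' addrACA.
- by rewrite Dr Dr' addrACA.
- by rewrite Z Z' mulrDr mulrDl.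
Qed.

Definition orthogonal_sum : quadratic_space s :=
  QSpace (fg_projective_prod (qmod_fgproj P) (qmod_fgproj Q)) osum_form_sesq.

End OrthogonalSum.

(* Main.v *)
From HB Require Import structures.
From mathcomp Require Import all_boot all_order all_algebra.
From mathcomp Require Import boolp classical_sets.
Require Import Defs.
Set Implicit Arguments.
Unset Strict Implicit.
Unset Printing Implicit Defensive.
Import GRing.Theory.
Local Open Scope ring_scope.
Local Open Scope classical_set_scope.

(** Cancelling (P, [beta]) reduces to cancelling hyperbolic planes. Take a dual
    basis (y_i, f_i) of P, with 1 <= i <= n. The map
    x |-> (f_i(x), beta(y_i, x))_i is an isometric embedding of P into H(A)^n,
    because the form of H(A)^n at the images of x and x' is
    sum_i f_i(x)^sigma beta(y_i, x') = beta(x, x')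
    ([embed_hyperbolic_space]). Since P is unimodular, it is an orthogonal
    summand of H(A)^n, so that an isometry P _|_ Q1 -> P _|_ Q2 extends to an
    isometry H(A)^n _|_ Q1 -> H(A)^n _|_ Q2 ([equivalent_fsum_extend]). It
    remains to cancel the planes H(A) one by one.

    In a quadratic space V, call two isotropic vectors v and w opposite when h
    is a perfect pairing between vA and wA. Then V is the orthogonal sum of
    vA + wA and {v, w}^perp, and {v, w}^perp is isometric to (vA)^perp / vA,
    hence does not depend on w: if w and w' are both opposite to v, then
    {v, w}^perp and {v, w'}^perp are isometric
    ([equivalent_orth_opposite]). Consequently {v, w}^perp does not change, up
    to isometry, along a chain of vectors in which neighbours are opposite.
    Cancelling H(A) means that {v, w}^perp and {v', w'}^perp are isometric
    whenever v, w and v', w' are two bases of hyperbolic planes in the same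
    space.

    Suppose more generally that v, w and v', w' span copies of
    H(eA) with e idempotent, i.e. ve = v, w e^sigma = w and
    h(v, w) = e^sigma. If eAe is local, a chain from v, w to v', w' always
    exists: when no two of the given vectors provide a shorter one, the vector
    w + w' + vt is opposite to both v and v', where t makes it isotropic
    ([local_orth_equivalent]). If eAe is not local, semiperfectness yields a
    nontrivial decomposition e = e1 + (e - e1) into orthogonal idempotents
    ([nonlocal_split]), and cancelling H(e1 A) and then H((e - e1)A) cancels
    H(eA) ([hyperbolic_cancellableD]). This process ends because A / Jac(A) is
    right noetherian ([idempotent_induction]), and e = 1 gives the claim.

    The summands Q1 and Q2 and the subspaces {v, w}^perp take part only through
    their forms, so the argument runs with sesquilinear forms on arbitrary
    modules ([form_module]). *)

(** * The Jacobson radical *)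

Section Jacobson.
Variable A : pzRingType.

Lemma proper_right_ideal_maximal (I : set A) :
  right_ideal I -> ~ I 1 -> exists2 M, maximal_right_ideal M & I `<=` M.
Proof.
move=> idI I1; have [I0 _ _] := idI.
pose T (X : set A) := X = set0 \/ [/\ right_ideal X, ~ X 1 & I `<=` X].
have [F FT Ftot|M [MT Mmax]] := @Zorn_bigcup A T.
  (* The empty set is admitted in T because the empty chain has empty union. *)
  have [[X [FX [x Xx]]]|noX] :=
      pselect (exists X, F X /\ exists x, X x); last first.
    left; apply/seteqP; split=> // x [X FX Xx].
    by exfalso; apply: noX; exists X; split=> //; exists x.
  right.
  have ideal Y y : F Y -> Y y -> [/\ right_ideal Y, ~ Y 1 & I `<=` Y].
    by move=> /FT [->|].
  split.
  - split.
    + by exists X => //; have [[]] := ideal _ _ FX Xx.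
    + move=> a b [Y FY Ya] [Z FZ Zb].
      have [[_ YD _] _ _] := ideal _ _ FY Ya.
      have [[_ ZD _] _ _] := ideal _ _ FZ Zb.
      have [YZ|ZY] := Ftot _ _ FY FZ.
        by exists Z => //; apply: ZD => //; apply: YZ.
      by exists Y => //; apply: YD => //; apply: ZY.
    + move=> a b [Y FY Ya]; exists Y => //.
      by have [[_ _ YM] _ _] := ideal _ _ FY Ya; apply: YM.
  - by move=> [Y FY Y1]; have [_ + _] := ideal _ _ FY Y1; apply.
  - by move=> a Ia; exists X => //; have [_ _] := ideal _ _ FX Xx; apply.
have TI : T I by right; split.
have [M0|[idM M1 IM']] := MT.
  exfalso; apply: (Mmax I) => //; rewrite M0; split=> //.
  by move=> I_0; apply: (I_0 0 I0).
exists M => //; split=> //; first by move=> MT'; apply: M1; rewrite MT'.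
move=> M' idM' MM'.
have [M'1|M'1] := pselect (M' 1).
  right; apply/seteqP; split=> // a _; rewrite -(mul1r a).
  by have [_ _] := idM'; apply.
left; apply: contrapT => neM; apply: (Mmax M').
  split=> // M'M; apply: neM; exact/seteqP.
by right; split=> // a /IM'; apply: MM'.
Qed.

Lemma principal_right_ideal (a : A) : right_ideal [set a * x | x in setT].
Proof.
split; first by exists 0; rewrite ?mulr0.
  by move=> _ _ [x _ <-] [y _ <-]; exists (x + y); rewrite ?mulrDr.
by move=> _ b [x _ <-]; exists (x * b); rewrite ?mulrA.
Qed.

Lemma jacobson_right_ideal : right_ideal (@jacobson A).
Proof.
split=> [I [[]]//|x y Jx Jy I mI|x a Jx I mI].
  by case: (mI) => -[_ + _] _ _; apply; [apply: Jx|apply: Jy].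
by case: (mI) => -[_ _ +] _ _; apply; apply: Jx.
Qed.

(** Otherwise (1 - j)A lies in a maximal right ideal; this ideal contains j, and
    hence 1. *)
Lemma jacobson_rinv (j : A) : jacobson j -> exists z, (1 - j) * z = 1.
Proof.
move=> Jj; apply: contrapT => no.
have [|M mM IM] := proper_right_ideal_maximal (principal_right_ideal (1 - j)).
  by move=> [z _ z1]; apply: no; exists z.
have [[M0 MD MM] MT _] := mM.
apply: MT; apply/seteqP; split=> // a _; rewrite -(mul1r a); apply: MM.
rewrite -(subrK j 1); apply: MD; last exact: Jj.
by apply: IM; exists 1; rewrite ?mulr1.
Qed.

(** A right inverse z of 1 - j has the form 1 + jz, so it has itself a right
    inverse, and this must be 1 - j. *)
Lemma jacobson_inv (j : A) :
  jacobson j -> exists z, (1 - j) * z = 1 /\ z * (1 - j) = 1.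
Proof.
move=> Jj; have [z jz] := jacobson_rinv Jj; exists z; split=> //.
have [_ JD JM] := jacobson_right_ideal.
have Jjz : jacobson (j * - z) by apply: JM.
have [y] := jacobson_rinv Jjz.
have -> : 1 - j * - z = z by rewrite mulrN opprK -jz mulrBl mul1r subrK.
move=> zy; have := congr1 ( *%R (1 - j)) zy.
by rewrite mulrA jz mul1r mulr1 => <-.
Qed.

Lemma jacobson_idem0 (e : A) : e * e = e -> jacobson e -> e = 0.
Proof.
move=> ee /jacobson_inv [z [_ ze]].
by rewrite -[e]mul1r -ze -mulrA mulrBl mul1r ee subrr mulr0.
Qed.

End Jacobson.

(** * Idempotents and local corner rings *)

Section Idempotents.
Variable A : pzRingType.

(** The units of the corner ring eAe, whose identity is e. *)
Definition corner_unit (e a : A) :=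
  exists b, [/\ e * b * e = b, a * b = e & b * a = e].

(** The corner ring eAe is local or zero. *)
Definition local_idempotent (e : A) :=
  e * e = e /\
  forall a, e * a * e = a -> corner_unit e a \/ corner_unit e (e - a).

Lemma corner_fixl (e a : A) : e * e = e -> e * a * e = a -> e * a = a.
Proof. by move=> ee <-; rewrite !mulrA ee. Qed.

Lemma corner_fixr (e a : A) : e * e = e -> e * a * e = a -> a * e = a.
Proof. by move=> ee <-; rewrite -!mulrA ee. Qed.

Lemma corner_unit_one_sided (e a b c : A) :
  e * e = e -> e * a * e = a -> e * b * e = b -> e * c * e = c ->
  a * b = e -> c * a = e -> corner_unit e a.
Proof.
move=> ee ea eb ec ab ca; exists b; split=> //.
suff -> : b = c by [].
by rewrite -(corner_fixl ee eb) -ca -mulrA ab (corner_fixr ee ec).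
Qed.

Lemma corner_unitN (e a : A) : corner_unit e a -> corner_unit e (- a).
Proof.
move=> [b [eb ab ba]]; exists (- b).
by rewrite mulrN mulNr eb mulrNN ab mulrNN ba.
Qed.

(** The product ab is idempotent, so it can only be a unit of eAe if it is e;
    if e - ab is the unit, then ab = 0 and e = (ba)(ba) = 0. *)
Lemma local_rinv (e a b : A) : local_idempotent e ->
  e * a * e = a -> e * b * e = b -> b * a = e -> corner_unit e a.
Proof.
move=> [ee loc] ea eb ba.
have eab : e * (a * b) * e = a * b.
  by rewrite mulrA (corner_fixl ee ea) -mulrA (corner_fixr ee eb).
have abab : a * b * (a * b) = a * b.
  by rewrite mulrA -[a * b * a]mulrA ba (corner_fixr ee ea).
have [[c [ec abc cab]]|[c [ec abc cab]]] := loc _ eab.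
  exists b; split=> //.
  by rewrite -[LHS](corner_fixl ee eab) -{1}cab -mulrA abab cab.
have ab0 : a * b = 0.
  rewrite -[LHS](corner_fixl ee eab) -cab -mulrA mulrBl abab.
  by rewrite (corner_fixl ee eab) subrr mulr0.
have e0 : e = 0.
  by rewrite -ee -ba mulrA -[b * a * b]mulrA ab0 mulr0 mul0r.
by exists 0; rewrite e0 !mulr0 mul0r.
Qed.

(** If x(a + b) = e, then xa and xb add up to e, so one of them is a unit of
    eAe. *)
Lemma local_unitD (e a b : A) : local_idempotent e ->
  e * a * e = a -> e * b * e = b -> corner_unit e (a + b) ->
  corner_unit e a \/ corner_unit e b.
Proof.
move=> le ea eb [x [ex abx xab]]; have [ee loc] := le.
have exa c : e * c * e = c -> e * (x * c) * e = x * c.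
  by move=> ec; rewrite mulrA (corner_fixl ee ex) -mulrA (corner_fixr ee ec).
have unit_fact c : e * c * e = c -> corner_unit e (x * c) -> corner_unit e c.
  move=> ec [y [ey _ yxc]]; apply: (local_rinv le ec (b := y * x)).
    by rewrite mulrA (corner_fixl ee ey) -mulrA (corner_fixr ee ex).
  by rewrite -mulrA.
case: (loc _ (exa _ ea)) => [|]; first by left; apply: unit_fact.
have -> : e - x * a = x * b by rewrite -xab mulrDr addrAC subrr add0r.
by right; apply: unit_fact.
Qed.

Lemma local_idempotent01 (e z : A) : local_idempotent e ->
  e * z * e = z -> z * z = z -> z = 0 \/ z = e.
Proof.
move=> [ee loc] ez zz; have ze := corner_fixr ee ez.
have [[c [_ zc _]]|[c [_ zc _]]] := loc _ ez.
  by right; rewrite -ze -zc mulrA zz.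
by left; rewrite -ze -zc mulrA mulrBr ze zz subrr mul0r.
Qed.

(** As j lies in eAe, 1 - j commutes with e, and e(1 - j)^-1 e is the inverse in
    the corner. *)
Lemma corner_unit_jacobson (e j : A) :
  e * e = e -> e * j * e = j -> jacobson j -> corner_unit e (e - j).
Proof.
move=> ee ej /jacobson_inv [z [jz zj]]; exists (e * z * e).
have ejl := corner_fixl ee ej; have ejr := corner_fixr ee ej.
split; first by rewrite !mulrA ee -mulrA ee.
  have -> : (e - j) * (e * z * e) = e * ((1 - j) * z) * e.
    by rewrite !mulrA mulrBl ee ejr mulrBr mulr1 ejl.
  by rewrite jz mulr1.
have -> : e * z * e * (e - j) = e * (z * (1 - j)) * e.
  by rewrite -!mulrA mulrBr ee ejl mulrBl mul1r ejr.
by rewrite zj mulr1.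
Qed.

Definition sub_idempotent (e' e : A) :=
  [/\ e' * e' = e', e * e' = e' & e' * e = e'].

End Idempotents.

(** * Splitting idempotents of a semiperfect ring *)

Section Semiperfect.
Variables (A B : pzRingType) (pi : {rmorphism A -> B}).
Hypothesis pi_surj : Defs.surjective pi.
Hypothesis pi_ker : forall x, pi x = 0 <-> jacobson x.
Hypothesis ssB : semisimple_ring B.
Hypothesis lift : idempotents_lift_mod (@jacobson A).

(** If I' is a complement of I and 1 = y + z with y in I and z in I', then for
    x in I the element zx = x - yx lies in both I and I'. *)
Lemma semisimple_ideal_idem (I : set B) : right_ideal I ->
  exists2 y, I y & forall x, I x -> y * x = x.
Proof.
move=> idI; have [I' [idI' II' sumI]] := ssB idI.
have [y [z [Iy I'z yz]]] := sumI 1; exists y => // x Ix.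
apply/esym/eqP; rewrite -subr_eq0 -{1}(mul1r x) -mulrBl yz addrC addKr.
apply/eqP; suff : [set 0] (z * x) by [].
have [I0 ID IM] := idI; have [_ _ I'M] := idI'.
rewrite -II'; split; last exact: I'M.
have -> : z * x = x + y * - x.
  by rewrite mulrN -{2}(mul1r x) yz mulrDl addrC addKr.
by apply: ID => //; apply: IM.
Qed.

(** An arbitrary idempotent lift g of c need not lie in eAe. However g(1 - e) is
    in the radical, so k = 1 - g(1 - e) is invertible, and the conjugate
    g' = k^-1 g k satisfies g'e = g'; then eg' is the lift in eAe. *)
Lemma lift_idempotent (e : A) (c : B) : e * e = e -> c * c = c ->
  pi e * c = c -> c * pi e = c ->
  exists2 e', sub_idempotent e' e & pi e' = c.
Proof.
move=> ee cc ec ce; have [x xc] := pi_surj c.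
have [|g [gg gx]] := @lift x.
  by apply/pi_ker; rewrite rmorphB rmorphM xc cc subrr.
have pg : pi g = c.
  by apply/eqP; rewrite -subr_eq0 -xc -rmorphB; apply/eqP/pi_ker.
have [|z [gz zg]] := @jacobson_inv _ (g * (1 - e)).
  by apply/pi_ker; rewrite rmorphM rmorphB rmorph1 pg mulrBr mulr1 ce subrr.
set k := 1 - g * (1 - e) in gz zg.
pose g' := z * g * k.
have g'e : g' * e = g'.
  apply/eqP; rewrite eq_sym -subr_eq0 -{1}[g']mulr1 -mulrBr; apply/eqP.
  rewrite /g' -!mulrA; have -> : g * (k * (1 - e)) = 0; last by rewrite mulr0.
  have e1e1 : (1 - e) * (1 - e) = 1 - e.
    by rewrite mulrBr mulr1 mulrBl mul1r ee subrr subr0.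
  by rewrite /k mulrBl mul1r -mulrA e1e1 mulrBr mulrA gg subrr.
have g'g' : g' * g' = g'.
  by rewrite /g' -!mulrA (mulrA k) gz mul1r (mulrA g) gg.
have pk : pi k = 1.
  rewrite rmorphB rmorph1 rmorphM rmorphB rmorph1 pg mulrBr mulr1 ce subrr.
  by rewrite subr0.
have pz : pi z = 1 by rewrite -[LHS]mul1r -pk -rmorphM gz rmorph1.
exists (e * g'); first split.
- by rewrite -mulrA (mulrA g') g'e g'g'.
- by rewrite mulrA ee.
- by rewrite -mulrA g'e.
- by rewrite !rmorphM pk pz mul1r mulr1 pg ec.
Qed.

(** Suppose that e is the only nonzero idempotent of eAe, and let f be the image
    of e in B. Every nonzero b in fBf is then right invertible in fBf: the right
    ideal bB is generated by an idempotent of fBf, which lifts to eAe and hence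
    is f. So fBf is a division ring or zero, and an element of eAe is a unit as
    soon as its image in fBf is one. *)
Lemma nonlocal_split (e : A) : e * e = e -> ~ local_idempotent e ->
  exists e', [/\ sub_idempotent e' e, e' <> 0 & e' <> e].
Proof.
move=> ee nloc; apply: contrapT => nosub; apply: nloc; split=> // a ea.
have prim e' : sub_idempotent e' e -> e' = 0 \/ e' = e.
  move=> se; apply: contrapT => /not_orP [n0 n1]; apply: nosub.
  by exists e'.
pose f := pi e.
have ff : f * f = f by rewrite -rmorphM ee.
have divring (b : B) : f * b * f = b ->
    b = 0 \/ exists2 r, f * r * f = r & b * r = f.
  move=> fb.
  have [y Iy yI] := semisimple_ideal_idem (principal_right_ideal b).
  have [x _ bx] := Iy.
  have yb : y * b = b by apply: yI; exists 1; rewrite ?mulr1.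
  have fy : f * y = y by rewrite -bx mulrA (corner_fixl ff fb).
  (* y generates bB but need not satisfy y f = y, whereas y f lies in fBf. *)
  have cc : y * f * (y * f) = y * f.
    by rewrite -mulrA (mulrA f) fy mulrA (yI y Iy).
  have [||e' se' pe'] := lift_idempotent ee cc.
  - by rewrite mulrA fy.
  - by rewrite -mulrA ff.
  case: (prim _ se') => e'E.
    left; rewrite -yb -(corner_fixl ff fb) mulrA -pe' e'E rmorph0 mul0r //.
  right; exists (f * x * f); first by rewrite !mulrA ff -!mulrA ff.
  by rewrite !mulrA (corner_fixr ff fb) bx -pe' e'E.
have [f0|fN0] := pselect (f = 0).
  left; have e0 : e = 0 by apply: jacobson_idem0 => //; apply/pi_ker.
  by exists 0; rewrite e0 !mulr0 mul0r; split.
have fpa : f * pi a * f = pi a by rewrite -!rmorphM ea.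
case: (divring _ fpa) => [/pi_ker Ja|[r fr ar]].
  by right; apply: corner_unit_jacobson.
left.
(* The right inverse r of pi a has a right inverse too, which must be pi a. *)
have [r0|[r' fr' rr']] := divring _ fr.
  by case: fN0; rewrite -ar r0 mulr0.
have ra : r * pi a = f.
  suff -> : pi a = r' by [].
  by rewrite -(corner_fixr ff fpa) -rr' mulrA ar (corner_fixl ff fr').
have [t0 t0r] := pi_surj r; pose t := e * t0 * e.
have et : e * t * e = t by rewrite /t !mulrA ee -mulrA ee.
have pt : pi t = r by rewrite /t !rmorphM t0r.
have prod_unit x y : e * x * e = x -> e * y * e = y -> pi (x * y) = f ->
    corner_unit e (x * y).
  move=> ex ey pxy; rewrite -[x * y](subKr e).
  apply: corner_unit_jacobson => //.
    rewrite mulrBr mulrBl !ee; congr (_ - _).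
    by rewrite mulrA (corner_fixl ee ex) -mulrA (corner_fixr ee ey).
  by apply/pi_ker; rewrite rmorphB pxy subrr.
have [|b [eb atb _]] := prod_unit _ _ ea et; first by rewrite rmorphM pt ar.
have [|b' [eb' _ tab']] := prod_unit _ _ et ea; first by rewrite rmorphM pt ra.
apply: (@corner_unit_one_sided _ e a (t * b) (b' * t)) => //.
- by rewrite mulrA (corner_fixl ee et) -mulrA (corner_fixr ee eb).
- by rewrite mulrA (corner_fixl ee eb') -mulrA (corner_fixr ee et).
- by rewrite mulrA.
- by rewrite -mulrA.
Qed.

(** There is no infinite strictly decreasing sequence e_0, e_1, ... of
    idempotents: the right ideals (1 - e_n)B would increase and their union
    would be generated by an element of one of them, so that (1 - e_n)B contains
    1 - e_(n+1) for some n; then e_n - e_(n+1) is an idempotent in the radical,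
    i.e. zero. *)
Lemma idempotent_induction (K : A -> Prop) :
  (forall e, e * e = e ->
    (forall e', sub_idempotent e' e -> e' <> e -> K e') -> K e) ->
  forall e, e * e = e -> K e.
Proof.
move=> step e ee; apply: contrapT => nKe.
pose bad := {e : A | e * e = e /\ ~ K e}.
have next (x : bad) :
    {y : bad | sub_idempotent (sval y) (sval x) /\ sval y <> sval x}.
  apply: cid; case: x => x [xx nKx] /=; apply: contrapT => no.
  apply: nKx; apply: step => // e' se' e'x; apply: contrapT => nKe'.
  apply: no; have e'e' : e' * e' = e' by case: se'.
  by exists (exist _ e' (conj e'e' nKe')).
pose seqb n := iter n (fun x => sval (next x)) (exist _ e (conj ee nKe) : bad).
pose en n := sval (seqb n).
have enP n : sub_idempotent (en n.+1) (en n) /\ en n.+1 <> en n.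
  by rewrite /en /=; case: (next (seqb n)).
have idem n : en n * en n = en n by have [] := svalP (seqb n).
have mono m n : (m <= n)%N -> en n * en m = en n.
  move=> /subnK <-; elim: (n - m)%N => [|k IH]; first by rewrite add0n.
  have [[_ _ ee'] _] := enP (k + m)%N.
  by rewrite addSn -{1}ee' -mulrA IH ee'.
(* The union of the right ideals (1 - e_n)B. *)
pose I : set B := [set x | exists n, (1 - pi (en n)) * x = x].
have Ile m n x : (m <= n)%N ->
    (1 - pi (en m)) * x = x -> (1 - pi (en n)) * x = x.
  move=> mn <-; rewrite mulrA; congr (_ * _).
  rewrite mulrBl mul1r mulrBr mulr1 -rmorphM mono //.
  by rewrite subrr subr0.
have idI : right_ideal I.
  split; first by exists 0%N; rewrite mulr0.
    move=> x y [m xm] [n yn]; exists (maxn m n).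
    by rewrite mulrDr (Ile m) ?leq_maxl // (Ile n) ?leq_maxr.
  by move=> x a [m xm]; exists m; rewrite mulrA xm.
have [y [n yn] yI] := semisimple_ideal_idem idI.
have [[_ e1 e2] e1n] := enP n; apply: e1n.
have : y * (1 - pi (en n.+1)) = 1 - pi (en n.+1).
  apply: yI; exists n.+1.
  by rewrite mulrBl mul1r mulrBr mulr1 -rmorphM idem subrr subr0.
move=> yE.
have pe : pi (en n - en n.+1) = 0.
  have : (1 - pi (en n)) * (1 - pi (en n.+1)) = 1 - pi (en n.+1).
    by rewrite -yE mulrA yn.
  rewrite mulrBl mul1r mulrBr mulr1 -rmorphM e1 => /eqP.
  by rewrite -subr_eq0 addrAC subrr add0r oppr_eq0 -rmorphB => /eqP.
apply/esym/eqP; rewrite -subr_eq0; apply/eqP/jacobson_idem0; last exact/pi_ker.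
by rewrite mulrBr !mulrBl !idem e1 e2 subrr subr0.
Qed.

End Semiperfect.

(** * Sesquilinear forms modulo a form parameter *)

Section AntiStructure.
Variables (A : pzRingType) (s : anti_structure A).
Local Notation u := (aunit s).
Local Notation uV := (aunitV s).

Lemma asigmaD a b : s (a + b) = s a + s b.
Proof. exact: (anti_autD (asigmaP s)). Qed.
Lemma asigmaM a b : s (a * b) = s b * s a.
Proof. exact: (anti_autM (asigmaP s)). Qed.
Lemma asigma1 : s 1 = 1.
Proof. exact: (anti_aut1 (asigmaP s)). Qed.
Lemma asigma0 : s 0 = 0.
Proof. by apply: (addrI (s 0)); rewrite -asigmaD !addr0. Qed.
Lemma asigmaN a : s (- a) = - s a.
Proof. by apply: (addrI (s a)); rewrite -asigmaD !subrr asigma0. Qed.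
Lemma asigma_inj : injective s.
Proof. exact: bij_inj (anti_aut_bij (asigmaP s)). Qed.
Lemma asigma_aunit : s u = uV.
Proof. by rewrite -[LHS]mulr1 -(aunit_mulV s) mulrA asigma_unit mul1r. Qed.
Lemma asigma_aunitV : s uV = u.
Proof.
have E : s uV * uV = 1 by rewrite -{2}asigma_aunit -asigmaM aunit_mulV asigma1.
by rewrite -[LHS]mulr1 -(aunit_Vmul s) mulrA E mul1r.
Qed.

End AntiStructure.

(** The right action of A: it hides the product of the converse ring, so that
    [ractM] has its factors in the usual order. *)
Definition ract (A : pzRingType) (M : lmodType A^c) (x : M) (a : A) : M :=
  (a : A^c) *: x.
Local Notation "x ** a" := (ract x a) (at level 40, left associativity).

Section RightAction.
Variables (A : pzRingType) (M : lmodType A^c).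
Implicit Types (x y : M) (a b : A).

Lemma ractM x a b : x ** (a * b) = x ** a ** b.
Proof. by rewrite /ract scalerA. Qed.
Lemma ractDl x y a : (x + y) ** a = x ** a + y ** a.
Proof. exact: scalerDr. Qed.
Lemma ractDr x a b : x ** (a + b) = x ** a + x ** b.
Proof. exact: scalerDl. Qed.
Lemma ract1 x : x ** 1 = x. Proof. exact: scale1r. Qed.
Lemma ract0 x : x ** 0 = 0. Proof. exact: scale0r. Qed.
Lemma ractNr x a : x ** (- a) = - (x ** a). Proof. exact: scaleNr. Qed.
Lemma ract_linear (N : lmodType A^c) (f : {linear M -> N}) x a :
  f (x ** a) = f x ** a.
Proof. exact: linearZ. Qed.

End RightAction.

(** Unlike in a quadratic space, the module is arbitrary: the orthogonal of a
    family of vectors is then again a form module. *)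
Record form_module (A : pzRingType) (s : anti_structure A) := FormModule {
  fmod :> lmodType A^c;
  fform : fmod -> fmod -> A;
  fform_sesq : sesquilinear s fform }.

Section FormModule.
Variables (A : pzRingType) (s : anti_structure A) (L : form_parameter s).
Local Notation u := (aunit s).
Implicit Types (V W X Y : form_module s).

Definition herm V (x y : V) : A := hform s (@fform _ _ V) x y.
Local Notation "'L[ a ]" := (fparam L a).

Lemma fparamN a : 'L[a] -> 'L[- a].
Proof. by move=> La; rewrite -sub0r; apply: fparamB => //; apply: fparam0. Qed.
Lemma fparamD a b : 'L[a] -> 'L[b] -> 'L[a + b].
Proof.
by move=> La Lb; rewrite -(opprK b); apply: fparamB => //; apply: fparamN.
Qed.

Lemma fparam_trans a b c : 'L[a - b] -> 'L[b - c] -> 'L[a - c].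
Proof. by move=> ab /(fparamD ab); rewrite addrA subrK. Qed.
Lemma fparam_sub_sym a b : 'L[a - b] -> 'L[b - a].
Proof. by move/fparamN; rewrite opprB. Qed.
Lemma fparam_addr a b c : 'L[a - b] -> 'L[a + c - (b + c)].
Proof. by rewrite opprD addrACA subrr addr0. Qed.
Lemma fparam_addl a b c : 'L[a - b] -> 'L[c + a - (c + b)].
Proof. by rewrite opprD addrACA subrr add0r. Qed.

Section Form.
Variable V : form_module s.
Implicit Types (x y z : V) (a b : A).

Lemma fformDl x y z : fform (x + y) z = fform x z + fform y z.
Proof. by case: (fform_sesq V). Qed.
Lemma fformDr x y z : fform x (y + z) = fform x y + fform x z.
Proof. by case: (fform_sesq V). Qed.
Lemma fform_ract x y a b : fform (x ** a) (y ** b) = s a * fform x y * b.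
Proof. by case: (fform_sesq V) => _ _; apply. Qed.
Lemma fform_ractl x y a : fform (x ** a) y = s a * fform x y.
Proof. by rewrite -{1}(ract1 y) fform_ract mulr1. Qed.
Lemma fform_ractr x y b : fform x (y ** b) = fform x y * b.
Proof. by rewrite -{1}(ract1 x) fform_ract asigma1 mul1r. Qed.

Lemma fform0r x : fform x 0 = 0.
Proof. by rewrite -(ract0 x) fform_ractr mulr0. Qed.

Lemma hermDl x y z : herm (x + y) z = herm x z + herm y z.
Proof. by rewrite /herm /hform fformDl fformDr asigmaD mulrDl addrACA. Qed.
Lemma hermDr x y z : herm x (y + z) = herm x y + herm x z.
Proof. by rewrite /herm /hform fformDl fformDr asigmaD mulrDl addrACA. Qed.
Lemma herm_ractl x y a : herm (x ** a) y = s a * herm x y.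
Proof.
by rewrite /herm /hform fform_ractl fform_ractr asigmaM mulrDr mulrA.
Qed.
Lemma herm_ractr x y a : herm x (y ** a) = herm x y * a.
Proof.
rewrite /herm /hform fform_ractl fform_ractr asigmaM asigmaK mulrDl -!mulrA.
by rewrite aunit_Vmul mulr1.
Qed.
Lemma herm0r x : herm x 0 = 0.
Proof. by rewrite -(ract0 x) herm_ractr mulr0. Qed.
Lemma herm0l x : herm 0 x = 0.
Proof. by rewrite -(ract0 x) herm_ractl asigma0 mul0r. Qed.
Lemma hermNl x y : herm (- x) y = - herm x y.
Proof.
by rewrite -[x in - x]ract1 -ractNr herm_ractl asigmaN asigma1 mulN1r.
Qed.
Lemma hermNr x y : herm x (- y) = - herm x y.
Proof. by rewrite -[y in - y]ract1 -ractNr herm_ractr mulrN1. Qed.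
Lemma hermBl x y z : herm (x - y) z = herm x z - herm y z.
Proof. by rewrite hermDl hermNl. Qed.
Lemma hermBr x y z : herm x (y - z) = herm x y - herm x z.
Proof. by rewrite hermDr hermNr. Qed.

Lemma hermC x y : herm y x = s (herm x y) * u.
Proof.
rewrite /herm /hform asigmaD asigmaM asigma_aunit asigmaK mulrDl addrC.
congr (_ + _).
by rewrite !mulrA aunit_Vmul mul1r -mulrA aunit_Vmul mulr1.
Qed.

Lemma hermC0 x y : herm x y = 0 -> herm y x = 0.
Proof. by move=> E; rewrite hermC E asigma0 mul0r. Qed.

(** Modulo the form parameter, x |-> beta(x, x) is a quadratic map with
    polarization h: the defect beta(y, x) - beta(y, x)^sigma u is in
    Lambda^min. *)
Lemma qformD x y :
  'L[fform (x + y) (x + y) - (fform x x + fform y y + herm x y)].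
Proof.
rewrite fformDl !fformDr /herm /hform.
have E (a b c d e : A) : a + b + (c + d) - (a + d + (b + e)) = c - e.
  rewrite [c + d]addrC [a + b + _]addrACA opprD [LHS]addrACA subrr add0r.
  by rewrite opprD addrACA subrr add0r.
by rewrite E; apply: fparam_min; exists (fform y x).
Qed.

Definition isotropic x := 'L[fform x x].

Lemma isotropic_herm x : isotropic x -> herm x x = 0.
Proof. by move/fparam_max => /= E; rewrite /herm /hform E subrr. Qed.

Lemma isotropic_ract x a : isotropic x -> isotropic (x ** a).
Proof. by rewrite /isotropic fform_ract; apply: fparamJ. Qed.

Lemma fparam_add_isotropic x y : isotropic y -> herm x y = 0 ->
  'L[fform (x + y) (x + y) - fform x x].
Proof.
move=> Ly xy; have D := qformD x y; rewrite xy addr0 in D.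
by have := fparamD D Ly; rewrite opprD addrA subrK.
Qed.

Lemma isotropicD3 x y z : isotropic x -> isotropic y -> isotropic z ->
  herm x y + herm (x + y) z = 0 -> isotropic (x + y + z).
Proof.
move=> Lx Ly Lz E; rewrite /isotropic.
set a := fform (x + y) (x + y); set c := fform z z; set q := fform _ _.
rewrite -(subrK (a + c + herm (x + y) z) q).
apply: fparamD; first exact: qformD.
have -> : a + c + herm (x + y) z =
    a - (fform x x + fform y y + herm x y) + (fform x x + fform y y + c).
  have -> : herm (x + y) z = - herm x y by apply/eqP; rewrite -addr_eq0 addrC E.
  have G (p q' r h : A) : p + r - h = p - (q' + h) + (q' + r).
    by rewrite opprD [- q' - h]addrC -!addrA addKr [r - h]addrC.
  exact: G.
by apply: fparamD; [exact: qformD|apply: fparamD => //; apply: fparamD].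
Qed.

Lemma isotropicN x : isotropic x -> isotropic (- x).
Proof. by move/(isotropic_ract (-1)); rewrite ractNr ract1. Qed.

End Form.

(** The class [beta] in S_P / Lambda_P amounts to the pair formed by h and the
    map x |-> beta(x, x) modulo the form parameter, so preserving the class
    means preserving both. *)
Definition preserves_form V W (f : V -> W) :=
  (forall x y, herm (f x) (f y) = herm x y) /\
  (forall x, 'L[fform (f x) (f x) - fform x x]).

Definition equivalent V W :=
  exists f : {linear V -> W}, bijective f /\ preserves_form f.

Lemma equivalent_trans V W X :
  equivalent V W -> equivalent W X -> equivalent V X.
Proof.
move=> [f [bf [fh fq]]] [g [bg [gh gq]]]; exists (g \o f : {linear V -> X}).
split; first exact: bij_comp.
split=> [x y|x] /=; first by rewrite gh fh.
by rewrite -(subrK (fform (f x) (f x)) (fform _ _)) -addrA; apply: fparamD.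
Qed.

Lemma linear_inverse (M N : lmodType A^c) (f : {linear M -> N}) : bijective f ->
  exists2 g : {linear N -> M}, cancel f g & cancel g f.
Proof.
move=> [g fg gf].
have lin_g : linear g.
  by move=> a x y; apply: (can_inj fg); rewrite linearP !gf.
pose g' : {linear N -> M} := HB.pack g (GRing.isLinear.Build _ _ _ _ g lin_g).
by exists g'.
Qed.

Lemma equivalent_sym V W : equivalent V W -> equivalent W V.
Proof.
move=> [f [/linear_inverse [g fg gf] [fh fq]]].
exists g; split; first by exists f.
split=> [x y|x]; first by rewrite -fh !gf.
by rewrite -opprB; apply: fparamN; rewrite -{1 2}(gf x).
Qed.

Lemma inj_surj_bij (M N : Type) (f : M -> N) :
  injective f -> Defs.surjective f -> bijective f.
Proof.
move=> fI fS; exists (fun y => sval (cid (fS y))) => [x|y].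
  by apply: fI; case: (cid _).
by case: (cid _).
Qed.

End FormModule.

(** * Orthogonals of opposite isotropic vectors *)

Section Orthogonal.
Variables (A : pzRingType) (s : anti_structure A).
Variables (V : form_module s) (v w : V).

Definition orth_pred : {pred V} :=
  [pred x | (herm v x == 0) && (herm w x == 0)].

Lemma orthP x : reflect (herm v x = 0 /\ herm w x = 0) (x \in orth_pred).
Proof. by apply: (iffP andP) => -[/eqP ? /eqP ?]. Qed.

Fact orth_submod_closed : submod_closed orth_pred.
Proof.
split=> [|a x y /orthP [vx wx] /orthP [vy wy]]; apply/orthP.
  by rewrite !herm0r.
by rewrite -[a *: x]/(x ** a) !hermDr !herm_ractr vx vy wx wy mul0r addr0.
Qed.
HB.instance Definition _ :=
  GRing.isSubmodClosed.Build A^c V orth_pred orth_submod_closed.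

Record orth_type :=
  OrthElt { orth_val :> V; orth_valP : orth_val \in orth_pred }.
HB.instance Definition _ := [isSub for orth_val].
HB.instance Definition _ := [Choice of orth_type by <:].
HB.instance Definition _ := [SubChoice_isSubLmodule of orth_type by <:].

Fact orth_form_sesq :
  sesquilinear s (fun x y : orth_type => fform (orth_val x) (orth_val y)).
Proof. by have [Dl Dr Z] := fform_sesq V; split=> *; rewrite /= ?Dl ?Dr ?Z. Qed.

Definition orth := FormModule orth_form_sesq.

Definition orth_elt (x : V) (vx : herm v x = 0) (wx : herm w x = 0) : orth :=
  @OrthElt x (introT (orthP x) (conj vx wx)).

End Orthogonal.

Section Cancellation.
Variables (A : pzRingType) (s : anti_structure A) (L : form_parameter s).
Local Notation u := (aunit s).
Local Notation uV := (aunitV s).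
Implicit Types (V W X Y : form_module s).
Local Notation isotropic := (isotropic L).
Local Notation equivalent := (equivalent L).
Local Notation preserves_form := (preserves_form L).

(** All identifications of an orthogonal with another form module are obtained
    from an isometric embedding onto {v, w}^perp. *)
Lemma equivalent_orth V W (v w : W) (i : {linear V -> W}) :
  injective i -> preserves_form i ->
  (forall x, herm v (i x) = 0 /\ herm w (i x) = 0) ->
  (forall y, herm v y = 0 -> herm w y = 0 -> exists x, i x = y) ->
  equivalent V (orth v w).
Proof.
move=> iI [ih iq] i0 iS.
pose j x : orth v w := orth_elt (i0 x).1 (i0 x).2.
have jl : linear j by move=> a x y; apply: val_inj; rewrite /= linearP.
pose j' : {linear V -> orth v w} :=
  HB.pack j (GRing.isLinear.Build _ _ _ _ j jl).
exists j'; split; last by split=> [x y|x]; [exact: ih|exact: iq].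
apply: inj_surj_bij => [x y /(congr1 val) /iI //|y].
have /orthP [vy wy] := orth_valP y.
by have [x xy] := iS _ vy wy; exists x; apply: val_inj.
Qed.

Lemma equivalent_orth_sub V (v w v' w' : V) :
  (forall x, herm v x = 0 /\ herm w x = 0 <-> herm v' x = 0 /\ herm w' x = 0) ->
  equivalent (orth v w) (orth v' w').
Proof.
move=> E; apply: (@equivalent_orth _ _ _ _ (val : {linear orth v w -> V})).
- exact: val_inj.
- by split=> // x; rewrite subrr; apply: fparam0.
- by move=> x; apply/E; apply/orthP; apply: orth_valP.
- move=> y vy wy; have /E [v'y w'y] : herm v' y = 0 /\ herm w' y = 0 by [].
  by exists (orth_elt v'y w'y).
Qed.

(** The pairing between vA and wA is perfect. This formulation mentions neither
    the annihilators of v and w nor the idempotents attached to them; it is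
    symmetric in v and w. *)
Definition opposite V (v w : V) :=
  [/\ isotropic v, isotropic w, exists g, v ** (g * herm w v) = v
    & exists g, w ** (g * herm v w) = w].

Lemma opposite_sym V (v w : V) : opposite v w -> opposite w v.
Proof. by case. Qed.

(** The vector v g h(w, x) is the component of x along vA in the decomposition
    of V as the sum of vA + wA and its orthogonal. The identity holds as
    h(w, x) is of the form h(w, v)k and h(w, v) g h(w, v) = h(w, v). *)
Lemma opposite_herm V (v w x : V) (g : A) : opposite v w ->
  v ** (g * herm w v) = v -> herm w v * (g * herm w x) = herm w x.
Proof.
move=> [_ _ _ [g' wE]] vE.
have [k ->] : exists k, herm w x = herm w v * k.
  exists (uV * s g' * herm w x).
  rewrite -{1}wE herm_ractl asigmaM !mulrA [herm w v](hermC v w).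
  by rewrite -[_ * u * uV]mulrA aunit_mulV mulr1.
have pgp : herm w v * (g * herm w v) = herm w v by rewrite -herm_ractr vE.
by rewrite (mulrA g) mulrA pgp.
Qed.

(** Both sides are isometric to (vA)^perp / vA. Explicitly, an element x of
    {v, w}^perp is moved along the isotropic submodule vA, to which it is
    orthogonal, until it is orthogonal to w'. *)
Lemma equivalent_orth_opposite V (v w w' : V) :
  opposite v w -> opposite v w' -> equivalent (orth v w) (orth v w').
Proof.
move=> vw vw'; have [Lv _ [g0 vE0] _] := vw; have [_ _ [g vE] _] := vw'.
have vv := isotropic_herm Lv.
pose i (x : orth v w) : V := val x - v ** (g * herm w' (val x)).
have il : linear i.
  move=> a x y; rewrite /i /= scalerBr -[a *: val x]/(val x ** a).
  rewrite -[a *: (v ** _)]/(v ** _ ** a) hermDr herm_ractr mulrDr ractDr.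
  by rewrite mulrA ractM opprD addrACA.
pose i' : {linear orth v w -> V} :=
  HB.pack i (GRing.isLinear.Build _ _ _ _ i il).
have vx (x : orth v w) : herm v (val x) = 0 by case/orthP: (orth_valP x).
have wx (x : orth v w) : herm w (val x) = 0 by case/orthP: (orth_valP x).
have w'i (x : V) : herm w' (x - v ** (g * herm w' x)) = 0.
  by rewrite hermBr herm_ractr (opposite_herm _ vw' vE) subrr.
apply: (@equivalent_orth _ _ _ _ i').
- move=> x y; rewrite /= /i => ixy.
  set a := g * _ in ixy; set b := g * _ in ixy.
  have E : val x - val y = v ** (a - b).
    rewrite ractDr ractNr; apply/eqP; rewrite subr_eq -addrA addrC -subr_eq.
    by rewrite ixy addrC.
  (* The difference lies in vA and is orthogonal to w, hence vanishes. *)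
  apply: val_inj; apply/eqP; rewrite -subr_eq0 E -vE0 -ractM -mulrA.
  by rewrite -herm_ractr -E hermBr !wx subrr mulr0 ract0.
- split=> [x y|x]; rewrite /= /i.
    rewrite hermBl !hermBr !herm_ractl !herm_ractr vx (hermC0 (vx x)) vv.
    by rewrite !(mul0r, mulr0) !subr0.
  apply: fparam_add_isotropic; first exact/isotropicN/isotropic_ract.
  by rewrite hermNr herm_ractr (hermC0 (vx x)) mul0r oppr0.
- by move=> x; rewrite /= w'i /i hermBr herm_ractr vv vx mul0r subr0.
- (* The preimage of y is its projection to the orthogonal of w. *)
  move=> y vy w'y.
  have vx0 : herm v (y - v ** (g0 * herm w y)) = 0.
    by rewrite hermBr herm_ractr vv vy mul0r subr0.
  have wx0 : herm w (y - v ** (g0 * herm w y)) = 0.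
    by rewrite hermBr herm_ractr (opposite_herm _ vw vE0) subrr.
  exists (orth_elt vx0 wx0); rewrite /= /i /=.
  set x := y - _; set c := g * herm w' x.
  pose d := g0 * herm w y + c.
  have -> : x - v ** c = y - v ** d by rewrite /d ractDr opprD addrA.
  have w'd : herm w' (v ** d) = 0.
    have := w'i x; rewrite -/c /x -addrA -opprD -ractDr -/d hermBr w'y sub0r.
    by move/eqP; rewrite oppr_eq0 => /eqP.
  suff -> : v ** d = 0 by rewrite subr0.
  by rewrite -vE -ractM -mulrA -herm_ractr w'd mulr0 ract0.
Qed.

Lemma equivalent_orthC V (v w : V) : equivalent (orth v w) (orth w v).
Proof. by apply: equivalent_orth_sub => x; split=> -[]. Qed.

(** The chain is w, v, w1, v', w'. *)
Lemma equivalent_orth_chain V (v w v' w' w1 : V) :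
  opposite v w -> opposite v' w' -> opposite v w1 -> opposite v' w1 ->
  equivalent (orth v w) (orth v' w').
Proof.
move=> vw v'w' vw1 v'w1.
apply: equivalent_trans (equivalent_orth_opposite vw vw1) _.
apply: equivalent_trans (equivalent_orthC _ _) _.
have := equivalent_orth_opposite (opposite_sym vw1) (opposite_sym v'w1).
move=> /equivalent_trans; apply.
apply: equivalent_trans (equivalent_orthC _ _) _.
exact: equivalent_orth_opposite.
Qed.

(** For e idempotent, vA + wA is then a copy of the hyperbolic space on eA: the
    dual of eA is e^sigma A. *)
Definition hyperbolic_pair (e : A) V (v w : V) :=
  [/\ v ** e = v, w ** s e = w, herm v w = s e, isotropic v & isotropic w].

Lemma hyperbolic_herm e V (v w : V) : hyperbolic_pair e v w -> herm w v = u * e.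
Proof.
by move=> [_ _ vw _ _]; rewrite hermC vw asigmaK -mulrA aunit_Vmul mulr1.
Qed.

Lemma hyperbolic_opposite e V (v w : V) : hyperbolic_pair e v w -> opposite v w.
Proof.
move=> vw; have [ve we h Lv Lw] := vw; split=> //.
  by exists uV; rewrite (hyperbolic_herm vw) mulrA aunit_Vmul mul1r.
by exists 1; rewrite h mul1r.
Qed.

(** * Cancellation of hyperbolic planes *)

Section LocalChain.
Variables (e : A) (V : form_module s).
Hypothesis le : local_idempotent e.
Let ee : e * e = e := proj1 le.

(** Through the factor u^-1, the values of h on wA and vA become elements of the
    corner ring eAe; in particular h(w, v) = ue gives e for a hyperbolic
    pair. *)
Lemma herm_corner (v w : V) : v ** e = v -> w ** s e = w ->
  e * (uV * herm w v) * e = uV * herm w v.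
Proof.
move=> ve we; rewrite -mulrA -mulrA -herm_ractr ve -{2}we herm_ractl asigmaK.
by rewrite !mulrA aunit_Vmul mul1r.
Qed.

Lemma corner_unit_opposite (v w : V) :
  v ** e = v -> w ** s e = w -> isotropic v -> isotropic w ->
  corner_unit e (uV * herm w v) -> opposite v w.
Proof.
move=> ve we Lv Lw [b [_ hb bh]]; split=> //.
  by exists (b * uV); rewrite -mulrA bh.
exists (s b); rewrite hermC mulrA -asigmaM.
have -> : herm w v * b = u * e by rewrite -hb !mulrA aunit_mulV mul1r.
by rewrite asigmaM asigma_aunit -mulrA aunit_Vmul mulr1.
Qed.

(** If h(w, v') or h(w', v) is a unit of the corner, then w or w' is opposite to
    both v and v'. Otherwise h(w + w', v) and h(w + w', v') are units, as each
    is the sum of a unit and a nonunit, and w1 = w + w' + vt is isotropic for a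
    suitable t. It is opposite to v because v is isotropic. If it is not
    opposite to v', the term t^sigma h(v, v') must be a unit, which makes
    h(v, v') an isomorphism from eA to its dual: then v and v' themselves are
    opposite. *)
Lemma local_orth_equivalent (v w v' w' : V) :
  hyperbolic_pair e v w -> hyperbolic_pair e v' w' ->
  equivalent (orth v w) (orth v' w').
Proof.
move=> vw v'w'; have ovw := hyperbolic_opposite vw.
have ov'w' := hyperbolic_opposite v'w'.
have [ve we hvw Lv Lw] := vw; have [v'e w'e hv'w' Lv' Lw'] := v'w'.
have chain w1 := equivalent_orth_chain ovw ov'w' (w1 := w1).
set a1 := uV * herm w v'; set a2 := uV * herm w' v.
have ea1 : e * a1 * e = a1 by apply: herm_corner.
have ea2 : e * a2 * e = a2 by apply: herm_corner.
have [ua1|na1] := pselect (corner_unit e a1).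
  by apply: (chain w) => //; apply: corner_unit_opposite.
have [ua2|na2] := pselect (corner_unit e a2).
  by apply: (chain w') => //; apply: corner_unit_opposite.
have [c [ec cb bc]] : corner_unit e (e + a2).
  have [|/corner_unitN|] := le.2 (- a2); first by rewrite mulrN mulNr ea2.
    by rewrite opprK.
  by rewrite opprK.
have hww' : herm (w + w') v = u * (e + a2).
  by rewrite hermDl (hyperbolic_herm vw) mulrDr /a2 mulrA aunit_mulV mul1r.
(* This t solves h(w, w') + h(w + w', v)t = 0. *)
pose t := - (c * uV * herm w w').
have te : t * s e = t by rewrite /t mulNr -mulrA -herm_ractr w'e.
have et : e * t = t by rewrite /t mulrN !mulrA (corner_fixl ee ec).
pose w1 := w + w' + v ** t.
have w1e : w1 ** s e = w1 by rewrite /w1 !ractDl we w'e -ractM te.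
have Lw1 : isotropic w1.
  apply: isotropicD3 => //; first exact: isotropic_ract.
  rewrite herm_ractr hww' /t mulrN !mulrA -(mulrA u) cb -asigmaK.
  by rewrite -herm_ractl we subrr.
have ow1 : opposite v w1.
  apply: corner_unit_opposite => //.
  rewrite /w1 hermDl hww' herm_ractl (isotropic_herm Lv) mulr0 addr0 mulrA.
  by rewrite aunit_Vmul mul1r; exists c.
set n := uV * herm w1 v'.
have en : e * n * e = n by apply: herm_corner.
have [un|nn] := pselect (corner_unit e n).
  by apply: (chain w1) => //; apply: corner_unit_opposite.
pose X := uV * s t.
have eX : e * X = X.
  by rewrite /X -{2}te asigmaM asigmaK !mulrA aunit_Vmul mul1r.
pose n2 := X * herm v v'.
have en2 : e * n2 * e = n2.
  by rewrite /n2 mulrA eX -mulrA -herm_ractr v'e.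
have nE : n = a1 + e + n2.
  rewrite /n /w1 !hermDl herm_ractl (hyperbolic_herm v'w') [LHS]mulrDr.
  rewrite [uV * (herm w _ + _)]mulrDr !mulrA.
  by rewrite aunit_Vmul mul1r.
have [b2 [eb2 n2b b2n]] : corner_unit e n2.
  have ue : corner_unit e (n + (- a1 + - n2)).
    rewrite nE -opprD [a1 + e]addrC -(addrA e) addrK.
    by exists e; rewrite !ee.
  have ea1N : e * - a1 * e = - a1 by rewrite mulrN mulNr ea1.
  have en2N : e * - n2 * e = - n2 by rewrite mulrN mulNr en2.
  case: (local_unitD le en _ ue) => [|//|].
    by rewrite mulrDr mulrDl ea1N en2N.
  case/(local_unitD le ea1N en2N) => /corner_unitN; rewrite opprK //.
(* As n2 = X h(v, v') is a unit, h(v, v') has a left inverse. That it also has a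
   right inverse follows from locality: z below is idempotent, being the product
   in one order of y and t whose product in the other order is s e. *)
have ov'v : opposite v v'.
  split=> //; last by exists (b2 * X); rewrite -mulrA b2n.
  pose y := s b2 * herm v' v; pose z := t * y.
  have yt : y * t = s e.
    rewrite -n2b /n2 /X !asigmaM asigma_aunitV /y hermC -!mulrA.
    congr (_ * (_ * _)).
    by rewrite asigmaK -!mulrA aunit_Vmul mulr1.
  have ez : e * z * e = z.
    by rewrite /z /y mulrA et -!mulrA -herm_ractr ve.
  have zz : z * z = z by rewrite /z mulrA -(mulrA t) yt te.
  suff zE : z = e by exists (t * s b2); rewrite -mulrA -/y -/z zE.
  have [z0|//] := local_idempotent01 le ez zz; rewrite z0.
  have se0 : s e = 0.
    by rewrite -ee asigmaM -yt -mulrA (mulrA t) -/z z0 mul0r mulr0.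
  by apply: (asigma_inj (s := s)); rewrite asigma0 se0.
apply: equivalent_trans (equivalent_orth_opposite ovw ov'v) _.
apply: equivalent_trans (equivalent_orthC _ _) _.
exact: equivalent_orth_opposite (opposite_sym ov'v) ov'w'.
Qed.
End LocalChain.

End Cancellation.

Section HyperbolicCancellation.
Variables (A : pzRingType) (s : anti_structure A) (L : form_parameter s).
Local Notation uV := (aunitV s).
Implicit Types (V W X Y : form_module s).
Local Notation isotropic := (isotropic L).
Local Notation equivalent := (equivalent L).
Local Notation preserves_form := (preserves_form L).
Local Notation hyperbolic_pair := (hyperbolic_pair L).

(** Cancellation of the hyperbolic space on eA, stated inside one space. *)
Definition hyperbolic_cancellable (e : A) :=
  forall V (v w v' w' : V), hyperbolic_pair e v w -> hyperbolic_pair e v' w' ->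
  equivalent (orth v w) (orth v' w').

Lemma hyperbolic_pair_sub e e' V (v w : V) : sub_idempotent e' e ->
  hyperbolic_pair e v w -> hyperbolic_pair e' (v ** e') (w ** s e').
Proof.
move=> [e'e' ee' e'e] [ve we vw Lv Lw]; split; try exact: isotropic_ract.
- by rewrite -ractM e'e'.
- by rewrite -ractM -asigmaM e'e'.
- by rewrite herm_ractl herm_ractr vw -!asigmaM e'e e'e'.
Qed.

Lemma hyperbolic_pair_image e V W (f : {linear V -> W}) (v w : V) :
  preserves_form f -> hyperbolic_pair e v w -> hyperbolic_pair e (f v) (f w).
Proof.
move=> [fh fq] [ve we vw Lv Lw]; split.
- by rewrite -ract_linear ve.
- by rewrite -ract_linear we.
- by rewrite fh.
- by rewrite /isotropic -(subrK (fform v v) (fform _ _)); apply: fparamD.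
- by rewrite /isotropic -(subrK (fform w w) (fform _ _)); apply: fparamD.
Qed.

Lemma equivalent_orth_image V W (f : {linear V -> W}) (v w : V) :
  bijective f -> preserves_form f -> equivalent (orth v w) (orth (f v) (f w)).
Proof.
move=> [g fg gf] [fh fq].
apply: (@equivalent_orth _ _ _ _ _ _ _
  (f \o (val : {linear orth v w -> V}) : {linear orth v w -> W})).
- by move=> x y /= /(can_inj fg) /val_inj.
- by split=> [x y|x] /=; [rewrite fh|apply: fq].
- by move=> x; rewrite /= !fh; apply/orthP; apply: orth_valP.
- move=> y; rewrite -(gf y) !fh => vy wy.
  by exists (orth_elt vy wy).
Qed.

(** The hyperbolic space on eA is the orthogonal sum of those on e1 A and
    (e - e1)A, and taking orthogonals can be done in two stages. *)
Lemma hyperbolic_pair_split e e1 V (v w : V) :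
  e * e = e -> sub_idempotent e1 e -> hyperbolic_pair e v w ->
  exists v2 w2 : orth (v ** e1) (w ** s e1),
    hyperbolic_pair (e - e1) v2 w2 /\ equivalent (orth v2 w2) (orth v w).
Proof.
move=> ee se vw; have [e1e1 ee1 e1e] := se; have [ve we hvw Lv Lw] := vw.
set e2 := e - e1.
have e2e2 : e2 * e2 = e2.
  by rewrite /e2 mulrBr !mulrBl ee e1e ee1 e1e1 subrr subr0.
have ee2 : e * e2 = e2 by rewrite /e2 mulrBr ee ee1.
have e2e : e2 * e = e2 by rewrite /e2 mulrBl ee e1e.
have e12 : e1 * e2 = 0 by rewrite /e2 mulrBr e1e e1e1 subrr.
have e21 : e2 * e1 = 0 by rewrite /e2 mulrBl ee1 e1e1 subrr.
have se2 : sub_idempotent e2 e by [].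
have [v2e w2e v2w2 Lv2 Lw2] := hyperbolic_pair_sub se2 vw.
have hwv := hyperbolic_herm vw.
have vv := isotropic_herm Lv; have ww := isotropic_herm Lw.
have v1v2 : herm (v ** e1) (v ** e2) = 0.
  by rewrite herm_ractl herm_ractr vv mul0r mulr0.
have w1v2 : herm (w ** s e1) (v ** e2) = 0.
  rewrite herm_ractl herm_ractr hwv asigmaK -!mulrA (mulrA uV) aunit_Vmul mul1r.
  by rewrite ee2 e12 mulr0.
have v1w2 : herm (v ** e1) (w ** s e2) = 0.
  by rewrite herm_ractl herm_ractr hvw -!asigmaM e2e e21 asigma0.
have w1w2 : herm (w ** s e1) (w ** s e2) = 0.
  by rewrite herm_ractl herm_ractr ww mul0r mulr0.
exists (orth_elt v1v2 w1v2), (orth_elt v1w2 w1w2); split.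
  by split=> //; apply: val_inj.
pose i : {linear orth (orth_elt v1v2 w1v2) (orth_elt v1w2 w1w2) -> V} :=
  (val : {linear orth (v ** e1) (w ** s e1) -> V}) \o
  (val : {linear orth (orth_elt v1v2 w1v2) (orth_elt v1w2 w1w2) ->
          orth (v ** e1) (w ** s e1)}).
have vE x : herm v x = herm (v ** e1) x + herm (v ** e2) x.
  by rewrite -hermDl -ractDr addrC subrK ve.
have wE x : herm w x = herm (w ** s e1) x + herm (w ** s e2) x.
  by rewrite -hermDl -ractDr -asigmaD addrC subrK we.
apply: (@equivalent_orth _ _ _ _ _ _ _ i).
- by move=> x y xy; do 2!apply: val_inj.
- by split=> // x; rewrite subrr; apply: fparam0.
- move=> x; have /orthP [v1x w1x] := orth_valP (val x).
  have /orthP [v2x w2x] := orth_valP x.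
  by rewrite vE wE v1x w1x !add0r.
- move=> y vy wy.
  have v1y : herm (v ** e1) y = 0 by rewrite herm_ractl vy mulr0.
  have w1y : herm (w ** s e1) y = 0 by rewrite herm_ractl wy mulr0.
  have v2y : herm (orth_elt v1v2 w1v2) (orth_elt v1y w1y) = 0.
    by rewrite -[LHS]/(herm (v ** e2) y) herm_ractl vy mulr0.
  have w2y : herm (orth_elt v1w2 w1w2) (orth_elt v1y w1y) = 0.
    by rewrite -[LHS]/(herm (w ** s e2) y) herm_ractl wy mulr0.
  by exists (orth_elt v2y w2y).
Qed.

(** Cancelling at e1 gives an isometry between the orthogonals of the e1-parts
    of the two pairs; it moves the (e - e1)-part of the first pair into the
    second orthogonal, where cancellation at e - e1 applies. *)
Lemma hyperbolic_cancellableD e e1 : e * e = e -> sub_idempotent e1 e ->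
  hyperbolic_cancellable e1 -> hyperbolic_cancellable (e - e1) ->
  hyperbolic_cancellable e.
Proof.
move=> ee se C1 C2 V v w v' w' vw v'w'.
have [v2 [w2 [vw2 E]]] := hyperbolic_pair_split ee se vw.
have [v2' [w2' [vw2' E']]] := hyperbolic_pair_split ee se v'w'.
have [f [bf ff]] :=
  C1 _ _ _ _ _ (hyperbolic_pair_sub se vw) (hyperbolic_pair_sub se v'w').
apply: equivalent_trans (equivalent_sym E) _.
apply: equivalent_trans E'.
apply: equivalent_trans (equivalent_orth_image v2 w2 bf ff) _.
exact: C2 (hyperbolic_pair_image ff vw2) vw2'.
Qed.

Lemma semiperfect_hyperbolic_cancellable e :
  semiperfect A -> e * e = e -> hyperbolic_cancellable e.
Proof.
move=> [[B [pi [pi_surj pi_ker ssB]]] lift].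
move: e; apply: (idempotent_induction pi_ker ssB) => e ee IH.
have [le|nle] := pselect (local_idempotent e).
  by move=> V v w v' w'; apply: local_orth_equivalent.
have [e1 [se1 e10 e1e]] := nonlocal_split pi_surj pi_ker ssB lift ee nle.
have [e1e1 ee1 e1e'] := se1.
apply: (hyperbolic_cancellableD ee se1); apply: IH => //.
  by split; rewrite ?mulrBr ?mulrBl ee ?ee1 ?e1e' ?e1e1 ?subrr ?subr0.
by move/(canRL (subrK _)) => E; apply: e10; apply: (addrI e); rewrite addr0 -E.
Qed.

End HyperbolicCancellation.

(** * Embedding unimodular spaces into hyperbolic spaces *)

Section Planes.
Variables (A : pzRingType) (s : anti_structure A) (L : form_parameter s).
Local Notation u := (aunit s).
Implicit Types (V W X Y Q : form_module s).
Local Notation equivalent := (equivalent L).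

Section Sum.
Variables V W : form_module s.

Fact fsum_form_sesq :
  sesquilinear s (fun z z' : V * W => fform z.1 z'.1 + fform z.2 z'.2).
Proof.
have [Dl Dr Z] := fform_sesq V; have [Dl' Dr' Z'] := fform_sesq W.
split=> [x x' y|x y y'|x y a b] /=.
- by rewrite Dl Dl' addrACA.
- by rewrite Dr Dr' addrACA.
- by rewrite Z Z' mulrDr mulrDl.
Qed.

Definition fsum := FormModule fsum_form_sesq.

Lemma herm_fsum (x y : fsum) : herm x y = herm x.1 y.1 + herm x.2 y.2.
Proof. by rewrite /herm /hform /= asigmaD mulrDl addrACA. Qed.

End Sum.

Lemma equivalent_fsumA X Y Q :
  equivalent (fsum (fsum X Y) Q) (fsum X (fsum Y Q)).
Proof.
pose f (z : fsum (fsum X Y) Q) : fsum X (fsum Y Q) := (z.1.1, (z.1.2, z.2)).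
have fl : linear f by [].
pose f' : {linear fsum (fsum X Y) Q -> fsum X (fsum Y Q)} :=
  HB.pack f (GRing.isLinear.Build _ _ _ _ f fl).
exists f'; split.
  by exists (fun z => ((z.1, z.2.1), z.2.2)) => [[[]]|[? []]].
split=> [x y|x]; first by rewrite !herm_fsum addrA.
by rewrite /= addrA subrr; apply: fparam0.
Qed.

Fact plane_form_sesq : sesquilinear s
  (fun x y : ((A^c)^o * (A^c)^o)%type => s (x.1 : A) * (y.2 : A)).
Proof.
split=> [x x' y|x y y'|x y a b] /=.
- by rewrite asigmaD mulrDl.
- by rewrite -mulrDr.
- change (s ((x.1 : A) * a) * ((y.2 : A) * b) = s a * (s x.1 * y.2) * b).
  by rewrite asigmaM !mulrA.
Qed.

Definition hyperbolic_plane := FormModule plane_form_sesq.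

(** Q1 and Q2 are the orthogonals, in the second sum, of its standard hyperbolic
    pair and of the image of the standard pair of the first sum. *)
Lemma hyperbolic_plane_cancel Q1 Q2 : hyperbolic_cancellable L 1 ->
  equivalent (fsum hyperbolic_plane Q1) (fsum hyperbolic_plane Q2) ->
  equivalent Q1 Q2.
Proof.
move=> C1.
pose v Q : fsum hyperbolic_plane Q := ((1, 0), 0).
pose w Q : fsum hyperbolic_plane Q := ((0, 1), 0).
have hv Q z : herm (v Q) z = z.1.2.
  rewrite herm_fsum herm0l addr0 /herm /hform /= asigma1 mulr0 asigma0 mul0r.
  by rewrite addr0; apply: mul1r.
have hw Q z : herm (w Q) z = u * z.1.1.
  rewrite herm_fsum herm0l addr0 /herm /hform /= asigma0 mul0r add0r mulr1.
  by rewrite asigmaK -mulrA aunit_Vmul mulr1.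
have vw Q : hyperbolic_pair L 1 (v Q) (w Q).
  split; rewrite ?asigma1 ?ract1 ?hv //; rewrite /isotropic /=.
    by rewrite fform0r mulr0 addr0; apply: fparam0.
  by rewrite fform0r asigma0 mul0r addr0; apply: fparam0.
have QE Q : equivalent Q (orth (v Q) (w Q)).
  have il : linear (fun y : Q => (0, y) : fsum hyperbolic_plane Q).
    by move=> a x y; apply: injective_projections; rewrite //= scaler0 addr0.
  pose i : {linear Q -> fsum hyperbolic_plane Q} :=
    HB.pack (fun y : Q => (0, y) : fsum hyperbolic_plane Q)
      (GRing.isLinear.Build _ _ _ _ _ il).
  apply: (@equivalent_orth _ _ _ _ _ _ _ i).
  - by move=> x y [].
  - split=> [x y|x]; first by rewrite herm_fsum herm0l add0r.
    by rewrite /= mulr0 add0r subrr; apply: fparam0.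
  - by move=> x; rewrite hv hw /= mulr0.
  - move=> [[a b] y]; rewrite hv hw /= => -> ua0; exists y.
    by rewrite /= -[a](@mul1r A) -(aunit_Vmul s) -mulrA ua0 mulr0.
move=> [f [bf ff]].
apply: equivalent_trans (QE Q1) _.
apply: equivalent_trans (equivalent_sym (QE Q2)).
apply: equivalent_trans (equivalent_orth_image (v Q1) (w Q1) bf ff) _.
exact: C1 (hyperbolic_pair_image ff (vw Q1)) (vw Q2).
Qed.

Fact zero_form_sesq : sesquilinear s (fun x y : 'rV[A^c]_0 => 0 : A).
Proof. by split=> *; rewrite ?addr0 ?mulr0 ?mul0r. Qed.

Fixpoint hyperbolic_space n : form_module s :=
  if n is n'.+1 then fsum hyperbolic_plane (hyperbolic_space n')
  else FormModule zero_form_sesq.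

Lemma hyperbolic_space_cancel n Q1 Q2 : hyperbolic_cancellable L 1 ->
  equivalent (fsum (hyperbolic_space n) Q1) (fsum (hyperbolic_space n) Q2) ->
  equivalent Q1 Q2.
Proof.
move=> C1; elim: n => [|n IH] E.
  have Z Q : equivalent (fsum (hyperbolic_space 0) Q) Q.
    exists (snd : {linear fsum (hyperbolic_space 0) Q -> Q}); split.
      by exists (fun y => (0, y)) => // -[x y]; rewrite (thinmx0 x).
    split=> [x y|x] /=; last by rewrite add0r subrr; apply: fparam0.
    by rewrite herm_fsum /(herm x.1) /hform asigma0 mul0r !add0r.
  exact: equivalent_trans (equivalent_sym (Z Q1)) (equivalent_trans E (Z Q2)).
apply: IH; apply: hyperbolic_plane_cancel => //.
apply: equivalent_trans (equivalent_sym (equivalent_fsumA _ _ _)) _.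
exact: equivalent_trans E (equivalent_fsumA _ _ _).
Qed.

(** The i-th component of k(x) in H(A) is (f_i(x), beta(y_i, x)). *)
Lemma embed_hyperbolic_space (P : form_module s) n (y : 'I_n -> P)
    (f : 'I_n -> {linear P -> (A^c)^o}) :
  exists k : {linear P -> hyperbolic_space n},
  forall x x', fform (k x) (k x') = \sum_i s (f i x) * fform (y i) x'.
Proof.
elim: n y f => [|n IH] y f.
  by exists (\0 : {linear P -> hyperbolic_space 0}) => x x'; rewrite big_ord0.
have [k kE] := IH (fun i => y (lift ord0 i)) (fun i => f (lift ord0 i)).
pose g x : hyperbolic_space n.+1 :=
  ((f ord0 x, fform (y ord0) x : (A^c)^o), k x).
have gl : linear g.
  move=> a x x'; rewrite /g !linearP fformDr -[a *: x]/(x ** a) fform_ractr.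
  by [].
pose g' : {linear P -> hyperbolic_space n.+1} :=
  HB.pack g (GRing.isLinear.Build _ _ _ _ g gl).
exists g' => x x'.
by rewrite /= kE big_ord_recl.
Qed.

End Planes.

Lemma fg_projective_dual_basis (A : pzRingType) (P : lmodType A^c) :
  fg_projective P ->
  exists n (y : 'I_n -> P) (f : 'I_n -> {linear P -> (A^c)^o}),
  forall x, x = \sum_i y i ** (f i x : A).
Proof.
move=> [[n [y gen]] proj].
pose F := {ffun 'I_n -> (A^c)^o}.
pose p (a : F) : P := \sum_i a i *: y i.
have pl : linear p.
  move=> b a a'; rewrite /p scaler_sumr -big_split; apply: eq_bigr => i _.
  by rewrite !ffunE scalerDl -scalerA.
pose p' : {linear F -> P} := HB.pack p (GRing.isLinear.Build _ _ _ _ p pl).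
have [x|h hE] := proj F P p' (idfun : {linear P -> P}).
  have [a ->] := gen x; exists [ffun i => a i].
  by rewrite /= /p; apply: eq_bigr => i _; rewrite ffunE.
have fl i : linear (fun x => h x i : (A^c)^o).
  by move=> a x x'; rewrite linearP !ffunE.
pose f i : {linear P -> (A^c)^o} :=
  HB.pack (fun x => h x i : (A^c)^o) (GRing.isLinear.Build _ _ _ _ _ (fl i)).
by exists n, y, f => x; rewrite -[LHS]hE.
Qed.

Section Unimodular.
Variables (A : pzRingType) (s : anti_structure A) (L : form_parameter s).
Implicit Types (V W X Y Q : form_module s).
Local Notation "'L[ a ]" := (fparam L a).
Local Notation equivalent := (equivalent L).
Local Notation preserves_form := (preserves_form L).

(** Bijectivity of x |-> h(x, _), without the module structure of the dual. *)
Definition perfect (P : form_module s) :=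
  (forall x : P, (forall y, herm x y = 0) -> x = 0) /\
  (forall f : {linear P -> (A^c)^o}, exists x, forall y, herm x y = f y).

(** This r is the adjoint of k for h; when k preserves h, z |-> k(r(z)) is
    the orthogonal projection onto the image of k. *)
Lemma perfect_retraction (P X : form_module s) (k : {linear P -> X}) :
  perfect P ->
  exists r : {linear X -> P}, forall z y, herm (r z) y = herm z (k y).
Proof.
move=> [P0 PS].
have ex z : {x : P | forall y, herm x y = herm z (k y)}.
  have fl : linear (fun y : P => herm z (k y) : (A^c)^o).
    move=> a x x'; rewrite linearP hermDr.
    by rewrite -[a *: k x]/(k x ** a) herm_ractr.
  apply: cid; have [x xE] := PS (HB.pack (fun y : P => herm z (k y) : (A^c)^o)
    (GRing.isLinear.Build _ _ _ _ _ fl) : {linear P -> (A^c)^o}).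
  by exists x.
have hE z y : herm (sval (ex z)) y = herm z (k y) by case: (ex z).
have rl : linear (fun z => sval (ex z)).
  move=> a z z'; apply/eqP; rewrite -subr_eq0; apply/eqP/P0 => y.
  rewrite hermBl hE !hermDl -[a *: z]/(z ** a).
  by rewrite -[a *: sval _]/(sval (ex z) ** a) !herm_ractl !hE subrr.
by exists (HB.pack (fun z => sval (ex z)) (GRing.isLinear.Build _ _ _ _ _ rl)
  : {linear X -> P}).
Qed.

(** X is the orthogonal sum of k(P) and its orthogonal, onto which c projects.
    The isometry acts by f on P _|_ Q1 and trivially on that orthogonal. *)
Lemma equivalent_fsum_extend (P X : form_module s) Q1 Q2 (k : {linear P -> X}) :
  perfect P -> preserves_form k ->
  equivalent (fsum P Q1) (fsum P Q2) -> equivalent (fsum X Q1) (fsum X Q2).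
Proof.
move=> perfP [kh kq] [f [bf [fh fq]]]; have [P0 _] := perfP.
have [r rE] := perfect_retraction k perfP.
have [g fg gf] := linear_inverse bf.
have rk x : r (k x) = x.
  apply/eqP; rewrite -subr_eq0; apply/eqP/P0 => y.
  by rewrite hermBl rE kh subrr.
pose c z := z - k (r z).
have rc z : r (c z) = 0 by rewrite /c linearB rk subrr.
have cE z : z = c z + k (r z) by rewrite /c subrK.
have ck z y : herm (c z) (k y) = 0.
  by rewrite -rE rc herm0l.
have cD z p : c (c z + k p) = c z.
  by rewrite {1}/c linearD rc rk add0r addrK.
have cl a z z' : c (a *: z + z') = a *: c z + c z'.
  by rewrite /c !linearP /= scalerBr scalerN addrACA.
clearbody c.
pose ext Q Q' (h : fsum P Q -> fsum P Q') (z : fsum X Q) : fsum X Q' :=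
  (c z.1 + k (h (r z.1, z.2)).1, (h (r z.1, z.2)).2).
have extK Q Q' (h : fsum P Q -> fsum P Q') (h' : fsum P Q' -> fsum P Q) :
    cancel h h' -> cancel (ext _ _ h) (ext _ _ h').
  move=> hK [z q]; rewrite /ext /=.
  have -> : r (c z + k (h (r z, q)).1) = (h (r z, q)).1.
    by rewrite linearD rc rk add0r.
  by rewrite cD -surjective_pairing hK /= -cE.
have extl : linear (ext _ _ f).
  move=> a [z q] [z' q']; rewrite /ext /=.
  have -> : (r (a *: z + z'), a *: q + q') =
      a *: ((r z, q) : fsum P Q1) + (r z', q') by rewrite linearP.
  rewrite linearP; apply: injective_projections => //=.
  by rewrite cl linearP [LHS]addrACA -scalerDr.
pose F : {linear fsum X Q1 -> fsum X Q2} :=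
  HB.pack (ext _ _ f) (GRing.isLinear.Build _ _ _ _ _ extl).
exists F; split; first by exists (ext _ _ g); apply: extK.
split.
  move=> [z q] [z' q']; have E := fh (r z, q) (r z', q').
  rewrite herm_fsum /=; move: E; rewrite !herm_fsum /=.
  rewrite hermDl !hermDr kh ck (hermC0 (ck _ _)) addr0 add0r => E.
  rewrite -[LHS]addrA E.
  rewrite [in RHS](cE z) [in RHS](cE z').
  by rewrite hermDl !hermDr kh ck (hermC0 (ck _ _)) addr0 add0r [LHS]addrA.
move=> [z q] /=.
have qD x y :
    'L[fform (c x + k y) (c x + k y) - (fform (c x) (c x) + fform y y)].
  have := qformD L (c x) (k y); rewrite ck addr0 => /fparam_trans; apply.
  exact/fparam_addl/kq.
have := fq (r z, q) => /=; set p := f _ => D.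
have D2 := qD z (r z); rewrite -cE in D2.
apply: fparam_trans (fparam_addr _ (qD z p.1)) _.
rewrite -(addrA (fform (c z) _)); apply: fparam_trans (fparam_addl _ D) _.
by rewrite addrA; apply/fparam_addr/fparam_sub_sym.
Qed.

End Unimodular.

(** * Quadratic spaces *)

Section QuadraticSpace.
Variables (A : pzRingType) (s : anti_structure A) (L : form_parameter s).
Implicit Types P Q : quadratic_space s.

Definition form_of P : form_module s := FormModule (qform_sesq P).

Lemma unimodular_perfect P : unimodular P -> perfect (form_of P).
Proof.
move=> [g adK gK]; split=> [x x0|f].
  have adI : injective (adjoint (P := P)) by exact: can_inj adK.
  apply: adI; rewrite linear0; apply: dual_ext => y; exact: x0.
by exists (g f) => y; rewrite -[in RHS](gK f).
Qed.

Lemma isometric_equivalent P Q : isometric L P Q ->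
  equivalent L (form_of P) (form_of Q).
Proof.
move=> [f [bf E]]; exists f; split=> //; split=> [x y|x].
  by have /(congr1 (fun h => h x y)) := hform_equiv E.
by have [_ _] := E; apply.
Qed.

Lemma equivalent_isometric P Q :
  equivalent L (form_of P) (form_of Q) -> isometric L P Q.
Proof.
move=> [f [bf [fh fq]]]; exists f; split=> //.
have [Dl Dr Z] := qform_sesq P; have [Dl' Dr' Z'] := qform_sesq Q.
split; last exact: fq.
  split=> [x x' y|x y y'|x y a b].
  - by rewrite linearD Dl Dl' opprD addrACA.
  - by rewrite linearD Dr Dr' opprD addrACA.
  - by rewrite !linearZ Z Z' mulrBr mulrBl.
move=> x y; apply/eqP; rewrite -addr_eq0 asigmaD asigmaN mulrBl addrACA -opprD.
by rewrite subr_eq0; apply/eqP/fh.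
Qed.

End QuadraticSpace.

Theorem corollary4p10 (A : pzRingType) (s : anti_structure A)
    (L : form_parameter s) (P Q1 Q2 : quadratic_space s) :
  semiperfect A ->
  unimodular P ->
  isometric L (orthogonal_sum P Q1) (orthogonal_sum P Q2) ->
  isometric L Q1 Q2.
Proof.
move=> spA uniP isoPQ; apply: equivalent_isometric.
have [n [y [f yf]]] := fg_projective_dual_basis (qmod_fgproj P).
have [k kE] := @embed_hyperbolic_space _ _ (form_of P) n y f.
have kf x x' : fform (k x) (k x') = fform x x'.
  rewrite kE [in RHS](yf x); symmetry.
  rewrite (big_morph (fun z => fform (z : form_of P) x')
    (id1 := 0) (op1 := +%R)).
  - by apply: eq_bigr => i _; rewrite fform_ractl.
  - by move=> z z'; rewrite fformDl.
  - by rewrite -(ract0 0) fform_ractl asigma0 mul0r.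
have kp : preserves_form L k.
  split=> [x x'|x]; first by rewrite /herm /hform !kf.
  by rewrite kf subrr; apply: fparam0.
apply: (@hyperbolic_space_cancel _ _ L n).
  by apply: semiperfect_hyperbolic_cancellable; rewrite ?mulr1.
apply: (equivalent_fsum_extend (unimodular_perfect uniP) kp).
exact: isometric_equivalent isoPQ.
Qed.
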